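(* Let $G$ be a graph and let $k$ be an integer with $\omega(G)\geq k\geq 2$ (so $N_k(G)\neq 0$). Then $G$ contains a subgraph $P_l\vee K_1$ for some integer $l$ with $l\geq\frac{(k+1)N_{k+1}(G)}{N_{k}(G)}+k-1$. In particular, $G$ contains a cycle of length $t$ for every integer $t$ with $3\le t\le \left\lceil\frac{(k+1)N_{k+1}(G)}{N_{k}(G)}\right\rceil+k$.
   Context: Graphs are finite and simple. $\omega(G)$ denotes the clique number of $G$, i.e. the number of vertices of a largest clique in $G$. $N_j(G)$ denotes the number of copies of $K_j$ in $G$, i.e. the number of $j$-element vertex subsets inducing a complete graph (so $N_j(G)=0$ for $j>\omega(G)$). $P_l$ denotes a path with $l$ vertices. For two (vertex-disjoint) graphs $G$ and $H$, the join $G\vee H$ is the graph with $V(G\vee H)=V(G)\cup V(H)$ and $E(G\vee H)=E(G)\cup E(H)\cup\{xy: x\in V(G),\ y\in V(H)\}$. ''Subgraph'' means not necessarily induced subgraph. The length of a cycle is its number of edges. *)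

(* Defs.v *)
From mathcomp Require Import all_boot all_order all_algebra.

Set Implicit Arguments.
Unset Strict Implicit.
Unset Printing Implicit Defensive.

Record sgraph := SGraph {
  vertex :> finType;
  edge : rel vertex;
  edge_sym : symmetric edge;
  edge_irrefl : irreflexive edge
}.

Definition is_clique (G : sgraph) (S : {set G}) : bool :=
  [forall x in S, forall y in S, (x != y) ==> edge x y].

Definition clique_number (G : sgraph) : nat :=
  \max_(S : {set G} | is_clique S) #|S|.

Definition num_cliques (j : nat) (G : sgraph) : nat :=
  #|[set S : {set G} | (#|S| == j) && is_clique S]|.

Definition path_rel (l : nat) : rel 'I_l :=
  fun i j => (i.+1 == j :> nat) || (j.+1 == i :> nat).

Lemma path_rel_sym (l : nat) : symmetric (@path_rel l).
Proof. by move=> i j; rewrite /path_rel orbC. Qed.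

Lemma path_rel_irrefl (l : nat) : irreflexive (@path_rel l).
Proof. by move=> i; rewrite /path_rel orbb gtn_eqF. Qed.

(* P_l : the index is the number of vertices, not of edges. *)
Definition path_graph (l : nat) : sgraph :=
  SGraph (@path_rel_sym l) (@path_rel_irrefl l).

Definition complete_rel (n : nat) : rel 'I_n := fun i j => i != j.

Lemma complete_rel_sym (n : nat) : symmetric (@complete_rel n).
Proof. by move=> i j; rewrite /complete_rel eq_sym. Qed.

Lemma complete_rel_irrefl (n : nat) : irreflexive (@complete_rel n).
Proof. by move=> i; rewrite /complete_rel eqxx. Qed.

Definition complete_graph (n : nat) : sgraph :=
  SGraph (@complete_rel_sym n) (@complete_rel_irrefl n).

Definition join_rel (G H : sgraph) : rel (G + H)%type :=
  fun u v => match u, v with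
             | inl x, inl y => edge x y
             | inr x, inr y => edge x y
             | _, _ => true
             end.

Lemma join_rel_sym (G H : sgraph) : symmetric (@join_rel G H).
Proof. by move=> [x|x] [y|y] //=; exact: edge_sym. Qed.

Lemma join_rel_irrefl (G H : sgraph) : irreflexive (@join_rel G H).
Proof. by move=> [x|x] /=; exact: edge_irrefl. Qed.

Definition join (G H : sgraph) : sgraph :=
  SGraph (@join_rel_sym G H) (@join_rel_irrefl G H).

(* G has a (not necessarily induced) subgraph isomorphic to H. *)
Definition contains_subgraph (G H : sgraph) : Prop :=
  exists f : H -> G,
    injective f /\ (forall x y : H, edge x y -> edge (f x) (f y)).

(* Meaningful as a graph cycle for t >= 3 only: [ucycle] also accepts the empty
   sequence and traversals of a single edge back and forth. *)
Definition has_cycle_of_length (G : sgraph) (t : nat) : Prop :=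
  exists c : seq G, size c = t /\ ucycle (@edge G) c.

(* Main.v *)
Require Import Defs.
From mathcomp Require Import all_boot all_order all_algebra.
From mathcomp Require Import zify.

Set Implicit Arguments.
Unset Strict Implicit.
Unset Printing Implicit Defensive.

(** Write N_j(W) for the number of j-cliques inside a vertex set W.  A fan
    P_l v K_1 is a vertex v together with a path on l vertices in its
    neighbourhood, so the question is how long a path some neighbourhood must
    contain.

    The core is a clique version of the Erdos-Gallai theorem
    ([cliques_ratio_path]): if every path in W has at most m vertices, then
    (s+1) N_{s+1}(W) <= (m-s) N_s(W) for every s >= 1; complete graphs on m
    vertices give equality, and s = 1 is the bound (m-1)|W|/2 on the number of
    edges.  The proof is by induction on |W|.  A vertex v of degree d < m/2 is
    deleted.  This destroys N_s cliques of size s+1 and N_{s-1} cliques of size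
    s, both counted in the neighbourhood of v, which has d vertices; there the
    trivial bound s N_s <= (d-s+1) N_{s-1} ([cliques_ratio_card]) shows that
    the loss is affordable.  If instead all degrees are at least m/2, a longest
    path through any given x closes up to a cycle on the same vertices by the
    rotation argument of Dirac and Posa.  Opening this cycle at x, maximality
    puts every neighbour of x on the path, so x has degree below m
    ([deg_lt_of_min_deg]).  Hence an s-clique has at most m-s common neighbours,
    which is enough because (s+1) N_{s+1} is the sum of these numbers over all
    s-cliques.

    For the theorem, let l be the largest number of vertices of a path in a
    neighbourhood of G.  Applying the core bound with s = k-1 to each
    neighbourhood and summing over all vertices turns N_k and N_{k-1} of the
    neighbourhoods into (k+1) N_{k+1}(G) and k N_k(G), so that
    (k+1) N_{k+1}(G) <= (l-k+1) N_k(G) ([fan_of_ratio]).  The first t-1 vertices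
    of the path together with the hub form a cycle of length t. *)

Import Order.TTheory GRing.Theory Num.Theory.
Local Open Scope ring_scope.

(** * Cliques, neighbourhoods and paths inside a vertex set *)

Definition nbh (G : sgraph) (v : G) : {set G} := [set u | edge v u].

Definition cliques (G : sgraph) (j : nat) (W : {set G}) : {set {set G}} :=
  [set S : {set G} | [&& S \subset W, #|S| == j & is_clique S]].

Definition path_in (G : sgraph) (W : {set G}) (p : seq G) : bool :=
  [&& uniq p, sorted (@edge G) p & all [in W] p].

Lemma is_cliqueP (G : sgraph) (S : {set G}) :
  reflect {in S &, forall x y, x != y -> edge x y} (is_clique S).
Proof.
apply: (iffP idP) => [cS x y xS yS xy | cS].
  by move: cS => /forall_inP/(_ x xS)/forall_inP/(_ y yS)/implyP; apply.
apply/forall_inP => x xS; apply/forall_inP => y yS; apply/implyP; exact: cS.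
Qed.

Lemma is_clique_subset (G : sgraph) (S S' : {set G}) :
  S \subset S' -> is_clique S' -> is_clique S.
Proof.
move=> /subsetP sub /is_cliqueP c; apply/is_cliqueP => x y /sub xS /sub yS.
exact: c.
Qed.

Lemma num_cliquesE (G : sgraph) (j : nat) :
  num_cliques j G = #|cliques j [set: G]|.
Proof. by apply: eq_card => S; rewrite !inE subsetT. Qed.

Lemma nbh_irrefl (G : sgraph) (v : G) : v \notin nbh v.
Proof. by rewrite inE edge_irrefl. Qed.

Lemma nbh_sym (G : sgraph) (u v : G) : (u \in nbh v) = (v \in nbh u).
Proof. by rewrite !inE edge_sym. Qed.

Lemma is_clique_setU1 (G : sgraph) (v : G) (S : {set G}) :
  v \notin S -> is_clique (v |: S) = (S \subset nbh v) && is_clique S.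
Proof.
move=> vS; apply/idP/andP => [cvS | [/subsetP Sv /is_cliqueP cS]].
  split; last exact: is_clique_subset (subsetUr _ _) cvS.
  apply/subsetP => u uS; rewrite inE; move/is_cliqueP: cvS; apply.
  - exact: setU11.
  - exact: setU1r.
  - by apply: contraNneq vS => ->.
apply/is_cliqueP => x y /setU1P[->|xS] /setU1P[->|yS]; rewrite ?eqxx //.
- by move=> _; move: (Sv _ yS); rewrite inE.
- by move=> _; move: (Sv _ xS); rewrite inE edge_sym.
- exact: cS.
Qed.

(** * Counting cliques *)

(** Removing v is a bijection from the cliques through v to the cliques of one
    vertex less in its neighbourhood. *)
Lemma card_cliques_through (G : sgraph) (W : {set G}) (v : G) (j : nat) :
  v \in W ->
  #|[set S in cliques j.+1 W | v \in S]| = #|cliques j (W :&: nbh v)|.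
Proof.
move=> vW; have notin S : S \in cliques j (W :&: nbh v) -> v \notin S.
  rewrite inE subsetI => /and3P[/andP[_ /subsetP Sv] _ _].
  by apply: contra (nbh_irrefl v) => /Sv.
rewrite -[RHS](@card_in_imset _ _ (fun S => v |: S)); last first.
  by move=> S S' /notin vS /notin vS' eq; rewrite -(setU1K vS) eq setU1K.
apply: eq_card => S; rewrite inE.
apply/andP/imsetP => [[Scl vS] | [S' S'cl ->]].
  exists (S :\ v); last by rewrite setD1K.
  move: Scl; rewrite !inE -{1 2 3}(setD1K vS) cardsU1 setD11 eqSS.
  rewrite is_clique_setU1 ?setD11 // subsetI => /and3P[/subUsetP[_ ->] ->].
  by move=> /andP[-> ->].
have vS' := notin _ S'cl; split; last exact: setU11.
move: S'cl; rewrite !inE subsetI => /and3P[/andP[S'W S'v] /eqP <- cl].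
by rewrite subUset sub1set vW S'W cardsU1 vS' is_clique_setU1 // S'v cl eqxx.
Qed.

(** Both sides count the pairs of a (j+1)-clique and one of its vertices. *)
Lemma sum_cliques_nbh (G : sgraph) (W : {set G}) (j : nat) :
  (\sum_(v in W) #|cliques j (W :&: nbh v)| = j.+1 * #|cliques j.+1 W|)%N.
Proof.
transitivity (\sum_(v in W) \sum_(S in cliques j.+1 W | v \in S) 1)%N.
  apply: eq_bigr => v vW; rewrite -card_cliques_through // sum1_card.
  by apply: eq_card => S; rewrite inE unfold_in.
rewrite (exchange_big_dep [in cliques j.+1 W]) /=; last by move=> v S _ /andP[].
rewrite mulnC -sum_nat_const; apply: eq_bigr => S Scl.
have /and3P[/subsetP SW /eqP Sj _] : [&& S \subset W, #|S| == j.+1 & is_clique S].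
  by move: Scl; rewrite inE.
rewrite -[RHS]Sj -sum1_card; apply: eq_bigl => v; rewrite Scl /=.
by case: (boolP (v \in S)) => [/SW ->|]; rewrite ?andbF.
Qed.

(** The pairs counted in [sum_cliques_nbh], grouped by the j-clique that is left
    when the distinguished vertex is removed. *)
Lemma sum_common_nbh (G : sgraph) (W : {set G}) (j : nat) :
  (\sum_(S in cliques j W) #|[set v in W | S \subset nbh v]|
     = j.+1 * #|cliques j.+1 W|)%N.
Proof.
rewrite -sum_cliques_nbh.
transitivity (\sum_(S in cliques j W) \sum_(v in W | S \subset nbh v) 1)%N.
  by apply: eq_bigr => S _; rewrite sum1_card; apply: eq_card => v; rewrite !inE.
rewrite (exchange_big_dep [in W]) /=; last by move=> S v _ /andP[].
apply: eq_bigr => v vW; rewrite -sum1_card; apply: eq_bigl => S.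
rewrite !inE subsetI.
by case: (S \subset W); case: (S \subset nbh v); rewrite ?vW /= ?andbT ?andbF.
Qed.

Lemma card_cliques_delete (G : sgraph) (W : {set G}) (v : G) (j : nat) :
  v \in W ->
  (#|cliques j.+1 W| = #|cliques j.+1 (W :\ v)| + #|cliques j (W :&: nbh v)|)%N.
Proof.
move=> vW; rewrite -card_cliques_through //.
rewrite -(cardsID [set S : {set G} | v \in S]) addnC; congr (_ + _)%N.
  apply: eq_card => S; rewrite !inE subsetD1.
  by case: (v \in S); rewrite ?andbF ?andbT.
by apply: eq_card => S; rewrite !inE.
Qed.

(** A vertex adjacent to all of S lies outside S, so a j-clique has at most
    |W| - j common neighbours in W. *)
Lemma cliques_ratio_card (G : sgraph) (W : {set G}) (j : nat) :
  (j.+1 * #|cliques j.+1 W| <= (#|W| - j) * #|cliques j W|)%N.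
Proof.
rewrite -sum_common_nbh mulnC -sum_nat_const.
apply: leq_sum => S; rewrite inE => /and3P[SW /eqP <- _].
rewrite -(cardsDS SW); apply/subset_leq_card/subsetP => v.
rewrite !inE => /andP[-> Sv]; rewrite andbT.
by apply: contra (nbh_irrefl v) => /(subsetP Sv).
Qed.

(** * Closing a longest path into a cycle *)

(** The pigeonhole step of the rotation argument.  There are size q pairs of
    consecutive entries of a :: q, so if f holds at the second entry and g at
    the first entry of more than size q pairs in total, some pair satisfies
    both. *)
Lemma crossing_split (T : Type) (f g : pred T) (a : T) (q : seq T) :
  (size q < count f q + count g (belast a q))%N ->
  exists p1 u v p2, [/\ a :: q = rcons p1 u ++ v :: p2, f v & g u].
Proof.
elim: q a => //= y q IH a; case: (boolP (f y && g a)) => [/andP[fy ga] _ | nfg lt].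
  by exists [::], a, y, q.
have [|p1 [u [v [p2 [eq fv gu]]]]] := IH y.
  by move: nfg lt; case: (f y); case: (g a) => //= _; lia.
by exists (a :: p1), u, v, p2; rewrite eq.
Qed.

Lemma path_in_cons (G : sgraph) (W : {set G}) (y : G) (p : seq G) :
  path_in W p -> y \in W -> y \notin p -> edge y (head y p) || (p == [::]) ->
  path_in W (y :: p).
Proof.
rewrite /path_in => /and3P[/= -> sp ->] yW -> e /=; rewrite yW !andbT.
by case: p sp e => //= z p -> /orP[->|].
Qed.

Lemma path_in_rev (G : sgraph) (W : {set G}) (p : seq G) :
  path_in W (rev p) = path_in W p.
Proof.
rewrite /path_in rev_uniq all_rev rev_sorted; congr [&& _, _ & _].
by apply: eq_sorted => x y; exact: edge_sym.
Qed.

(** For the end a of a longest path all neighbours lie on the path, so its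
    degree can be read off the path. *)
Lemma deg_le_count (G : sgraph) (W : {set G}) (a : G) (q : seq G) :
  {subset W :&: nbh a <= a :: q} ->
  (#|W :&: nbh a| <= count (edge a) q)%N.
Proof.
move=> sub; rewrite -size_filter cardE; apply: uniq_leq_size (enum_uniq _) _.
move=> y; rewrite mem_enum => yA; move: (sub y yA); move: yA.
rewrite !inE mem_filter => /andP[_ e] /orP[/eqP ya|->]; last by rewrite e.
by move: e; rewrite ya edge_irrefl.
Qed.

(** Crossing chords from the ends of a path: run from a to u, jump to the last
    vertex, run backwards to v, and return to a. *)
Lemma crossing_cycle (G : sgraph) (a u v : G) (p1 p2 q : seq G) :
  a :: q = rcons p1 u ++ v :: p2 -> sorted (@edge G) (a :: q) ->
  edge a v -> edge (last a q) u ->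
  cycle (@edge G) (rcons p1 u ++ rev (v :: p2)).
Proof.
move=> eq sp av bu.
have [q1 eq1 uE] : exists2 q1, rcons p1 u = a :: q1 & last a q1 = u.
  case: p1 eq => [|h p1] /= [-> _]; first by exists [::].
  by exists (rcons p1 u); rewrite // last_rcons.
move: eq sp bu; rewrite eq1 => -[->] /=.
rewrite cat_path last_cat /= uE => /and3P[pq1 uv pp2] bu.
rewrite rcons_cat cat_path pq1 uE /= -rev_cons.
have := rev_path (@edge G) a (rcons (v :: p2) u).
rewrite last_rcons belast_rcons => ->.
rewrite (eq_path (e' := @edge G)); last by move=> x y; exact: edge_sym.
by rewrite rcons_cons /= rcons_path av pp2.
Qed.

Lemma longest_path_through (G : sgraph) (W : {set G}) (x : G) :
  x \in W ->
  exists p, [/\ path_in W p, x \in p &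
    forall q, path_in W q -> x \in q -> (size q <= size p)%N].
Proof.
move=> xW; pose P n := [exists p : n.-tuple G, path_in W p && (x \in (p : seq G))].
have exP : exists n, P n.
  by exists 1%N; apply/existsP; exists [tuple x]; rewrite /path_in /= xW inE eqxx.
have bdP n : P n -> (n <= #|G|)%N.
  move=> /existsP[p /andP[/and3P[up _ _] _]].
  by rewrite -(size_tuple p) -(card_uniqP up) max_card.
case: (ex_maxnP exP bdP) => n /existsP[p /andP[pW xp]] max.
exists p; split=> // q qW xq; rewrite size_tuple; apply: max.
by apply/existsP; exists (in_tuple q); rewrite qW.
Qed.

(** Requiring the longest path to pass through x, rather than to be longest
    overall, makes the argument local to the component of x: the path closes to
    a cycle, which can be reopened with x as its first vertex. *)
Lemma deg_lt_of_min_deg (G : sgraph) (W : {set G}) (m : nat) (x : G) :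
  (forall p, path_in W p -> (size p <= m)%N) ->
  (forall v, v \in W -> (m <= 2 * #|W :&: nbh v|)%N) ->
  x \in W -> (#|W :&: nbh x| < m)%N.
Proof.
move=> short mindeg xW.
have [p [pW xp max]] := longest_path_through xW.
have grow y q : path_in W (y :: q) -> x \in q -> (size q < size p)%N.
  by move=> yqW xq; apply: (max (y :: q)) => //; rewrite inE xq orbT.
have end_nbrs a q : path_in W (a :: q) -> x \in a :: q ->
    size (a :: q) = size p -> {subset W :&: nbh a <= a :: q}.
  move=> aqW xaq sz y; rewrite !inE => /andP[yW ay]; rewrite -in_cons.
  apply: contraT => ynot.
  have /grow/(_ xaq) : path_in W [:: y, a & q].
    by rewrite path_in_cons //= edge_sym ay.
  by rewrite sz ltnn.
have deg a q : path_in W (a :: q) -> x \in a :: q ->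
    size (a :: q) = size p -> (m <= 2 * count (edge a) q)%N.
  move=> aqW xaq sz; have aW : a \in W by case/and3P: aqW => _ _ /andP[].
  apply: leq_trans (mindeg a aW) _; rewrite leq_mul2l /=.
  exact/deg_le_count/end_nbrs.
case: p => [//|a q] in pW xp max grow end_nbrs deg *.
(* The last vertex is treated as the first vertex of the reversed path. *)
have lastE : rev (a :: q) = last a q :: rev (belast a q).
  by rewrite lastI rev_rcons.
have degl : (m <= 2 * count (edge (last a q)) (belast a q))%N.
  rewrite -count_rev; apply: deg; first by rewrite -lastE path_in_rev.
  - by rewrite -lastE mem_rev.
  - by rewrite -lastE size_rev.
have [|p1 [u [v [p2 [eq av bu]]]]] :=
    @crossing_split _ (edge a) (edge (last a q)) a q.
  by have := deg a q pW xp erefl; have /= := short _ pW; lia.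
have [upq spq aW] := and3P pW.
have cyc := crossing_cycle eq spq av bu.
set c := rcons p1 u ++ rev (v :: p2) in cyc.
have permc : perm_eq c (a :: q).
  by rewrite eq perm_cat2l perm_rev.
have xc : x \in c by rewrite (perm_mem permc).
have [i s rotc] := rot_to xc.
have perms : perm_eq (x :: s) (a :: q) by rewrite -rotc perm_rot.
have xsW : path_in W (x :: s).
  apply/and3P; split.
  - by rewrite (perm_uniq perms).
  - by move: cyc; rewrite -(rot_cycle i) rotc /= rcons_path => /andP[].
  - by rewrite (perm_all _ perms).
have sub := end_nbrs x s xsW (mem_head x s) (perm_size perms).
have := deg_le_count sub => /leq_ltn_trans; apply.
apply: leq_ltn_trans (count_size _ _) _; exact: short xsW.
Qed.

(** * A clique version of the Erdos-Gallai theorem *)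

(** The induction deletes a vertex of degree below m/2 while there is one; when
    there is none, [deg_lt_of_min_deg] bounds the common neighbours of every
    single clique.  Here s = j+1, so that the smaller cliques are nonempty and
    lie in the closed neighbourhood of one of their vertices. *)
Lemma cliques_ratio_path (G : sgraph) (W : {set G}) (m j : nat) :
  (forall p, path_in W p -> (size p <= m)%N) ->
  (j.+2 * #|cliques j.+2 W| <= (m - j.+1) * #|cliques j.+1 W|)%N.
Proof.
have [n leWn] := ubnP #|W|; elim: n => // n IH in W leWn * => short.
case: (boolP [exists v in W, 2 * #|W :&: nbh v| < m]%N).
  case/exists_inP => v vW smalldeg.
  rewrite !(card_cliques_delete _ vW) !mulnDr.
  apply: leq_add.
    apply: IH => [|p /and3P[up sp /allP pW]].
      by move: leWn; rewrite (cardsD1 v) vW.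
    apply: short; rewrite /path_in up sp; apply/allP => y /pW /=.
    by rewrite in_setD1 => /andP[].
  have := cliques_ratio_card (W :&: nbh v) j.
  set d := #|W :&: nbh v| in smalldeg *.
  (* Comparing the neighbourhood's ratio (d - j) / (j + 1) with the target ratio
     (m - j - 1) / (j + 2); this is where 2 d < m enters. *)
  have ineq : (j.+2 * (d - j) <= j.+1 * (m - j.+1))%N.
    have [-> | pos] := posnP (d - j); first by rewrite muln0.
    apply: leq_trans (_ : j.+1 * (j + 2 * (d - j)) <= _)%N; first by nia.
    by rewrite leq_mul2l; lia.
  move=> /(leq_mul (leqnn j.+2)) le; rewrite -(leq_pmul2l (ltn0Sn j)).
  by rewrite mulnCA (leq_trans le) // !mulnA leq_mul2r ineq orbT.
rewrite negb_exists_in => /forall_inP large.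
have deg v : v \in W -> (#|W :&: nbh v| < m)%N.
  apply: deg_lt_of_min_deg short _ => u /large.
  by rewrite -leqNgt.
rewrite -sum_common_nbh mulnC -sum_nat_const.
apply: leq_sum => S; rewrite inE => /and3P[/subsetP SW /eqP Sj cS].
have [x xS] : exists x, x \in S by apply/set0Pn; rewrite -card_gt0 Sj.
(* The other j members of S and the common neighbours of S are disjoint sets of
   neighbours of x. *)
apply: (@leq_trans (#|W :&: nbh x| - j)%N); last first.
  by have := deg x (SW _ xS); lia.
have Sx : #|S :\ x| = j by move: Sj; rewrite (cardsD1 x) xS => -[].
rewrite leq_subRL; last first.
  rewrite -Sx; apply/subset_leq_card/subsetP => y; rewrite !inE => /andP[yx yS].
  by rewrite SW //=; move/is_cliqueP: cS; apply; rewrite // eq_sym.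
rewrite -Sx -cardsUI addnC [X in (X + _)%N](_ : _ = 0%N) ?add0n; last first.
  apply/eqP; rewrite cards_eq0 -subset0; apply/subsetP => y.
  rewrite !inE => /and3P[/andP[_ yS] _ /subsetP/(_ y yS)].
  by rewrite inE edge_irrefl.
apply/subset_leq_card/subsetP => y; rewrite !inE.
case/orP => [/andP[yx yS]|/andP[-> /subsetP/(_ x xS)]].
  by rewrite SW //=; move/is_cliqueP: cS; apply; rewrite // eq_sym.
by rewrite inE edge_sym.
Qed.

(** * Fans and their cycles *)

Lemma path_in_clique (G : sgraph) (W S : {set G}) :
  S \subset W -> is_clique S -> path_in W (enum S).
Proof.
move=> /subsetP SW /is_cliqueP cS; rewrite /path_in enum_uniq /=.
apply/andP; split; last by apply/allP => x; rewrite mem_enum; exact: SW.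
apply: pairwise_sorted.
have := enum_uniq S; rewrite uniq_pairwise.
apply: (sub_in_pairwise (P := [in S])).
  by move=> x y xS yS; exact: cS.
by apply/allP => x; rewrite mem_enum.
Qed.

(** The path is a longest one over all neighbourhoods.  The bound k-1 on its
    length comes from a k-clique minus a vertex; it makes the truncated
    subtraction in the conclusion a true difference. *)
Lemma fan_of_ratio (G : sgraph) (k : nat) :
  (2 <= k)%N -> (0 < #|cliques k [set: G]|)%N ->
  exists (v : G) (p : seq G), [/\ path_in (nbh v) p, (k.-1 <= size p)%N &
    (k.+1 * #|cliques k.+1 [set: G]|
       <= (size p - k.-1) * #|cliques k [set: G]|)%N].
Proof.
case: k => [|[|k]] //= _ Nk.
pose P n := [exists v : G, exists p : n.-tuple G, path_in (nbh v) (p : seq G)].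
have bdP n : P n -> (n <= #|G|)%N.
  move=> /existsP[v /existsP[p /and3P[up _ _]]].
  by rewrite -(size_tuple p) -(card_uniqP up) max_card.
have Pk : P k.+1.
  have /card_gt0P[S] := Nk; rewrite inE => /and3P[_ /eqP Sk cS].
  have [v vS] : exists v, v \in S by apply/set0Pn; rewrite -card_gt0 Sk.
  have szS : size (enum (S :\ v)) == k.+1.
    by rewrite -cardE -eqSS -Sk (cardsD1 v S) vS.
  apply/existsP; exists v; apply/existsP; exists (Tuple szS).
  have : is_clique (v |: S :\ v) by rewrite setD1K.
  by rewrite is_clique_setU1 ?setD11 // => /andP[]; exact: path_in_clique.
case: (ex_maxnP (ex_intro (fun n => P n) _ Pk) bdP).
move=> l /existsP[v /existsP[p pv]] max.
exists v, p; rewrite size_tuple; split=> //; first exact: max.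
have short (w : G) (q : seq G) : path_in (nbh w) q -> (size q <= l)%N.
  move=> qw; apply: max; apply/existsP; exists w.
  by apply/existsP; exists (in_tuple q).
(* After multiplication by k both sides are sums over the neighbourhoods. *)
rewrite -(leq_pmul2l (ltn0Sn k.+1)) [leqRHS]mulnCA.
rewrite -!sum_cliques_nbh !big_distrr /=; apply: leq_sum => w _.
rewrite setTI; exact: cliques_ratio_path (short w).
Qed.

Lemma fan_contains_join (G : sgraph) (v : G) (p : seq G) :
  path_in (nbh v) p ->
  contains_subgraph G (join (path_graph (size p)) (complete_graph 1)).
Proof.
move=> /and3P[up sp /allP pv].
have adj (i : 'I_(size p)) : edge v (nth v p i).
  by have := pv _ (mem_nth v (ltn_ord i)); rewrite /= inE.
exists (fun z => match z with inl i => nth v p (i : 'I__) | inr _ => v end).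
split.
- move=> [i|i] [j|j] /=.
  + by move/eqP; rewrite nth_uniq // => /eqP/val_inj ->.
  + by move=> eq; have := adj i; rewrite eq edge_irrefl.
  + by move=> eq; have := adj j; rewrite -eq edge_irrefl.
  + by move=> _; rewrite (ord1 i) (ord1 j).
have step (i j : 'I_(size p)) : i.+1 = j -> edge (nth v p i) (nth v p j).
  by move=> eq; rewrite -eq; apply: (sortedP v sp); rewrite eq.
move=> [i|i] [j|j] //=.
- by case/orP => /eqP /step; rewrite // edge_sym.
- by rewrite edge_sym.
- by rewrite /edge /= /complete_rel (ord1 i) (ord1 j) eqxx.
Qed.

Lemma fan_has_cycle (G : sgraph) (v : G) (p : seq G) (t : nat) :
  path_in (nbh v) p -> (3 <= t)%N -> (t <= (size p).+1)%N ->
  has_cycle_of_length G t.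
Proof.
move=> /and3P[up sp /allP pv] t3 tp.
have st : size (take t.-1 p) = t.-1 by rewrite size_takel //; lia.
exists (v :: take t.-1 p); split; first by rewrite /= st; lia.
have adj y : y \in take t.-1 p -> edge v y.
  by move=> /mem_take /pv /=; rewrite inE.
rewrite /ucycle /= take_uniq // andbT; apply/andP; split; last first.
  by apply/negP => /adj; rewrite edge_irrefl.
have := take_sorted t.-1 sp.
case eq: (take t.-1 p) => [|y q] in st adj * => /=; first by move: st => /=; lia.
move=> pyq; rewrite rcons_path adj ?mem_head // pyq /= edge_sym adj //.
exact: mem_last.
Qed.

Theorem theorem1p4 (G : sgraph) (k : nat)
    (hk : (2 <= k)%N) (homega : (k <= clique_number G)%N) :
  (exists l : nat,
      (k.+1)%:R * (num_cliques k.+1 G)%:R / (num_cliques k G)%:R + k%:R - 1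
        <= l%:R :> rat
      /\ contains_subgraph G (join (path_graph l) (complete_graph 1)))
  /\
  (forall t : nat,
      (3 <= t)%N ->
      t%:Z <= Num.ceil ((k.+1)%:R * (num_cliques k.+1 G)%:R
                          / (num_cliques k G)%:R : rat) + k%:Z ->
      has_cycle_of_length G t).
Proof.
have Nk : (0 < #|cliques k [set: G]|)%N.
  have [|S cS SE] := @eq_bigmax_cond _ [pred S : {set G} | is_clique S]
                                     (fun S => #|S|).
    apply/card_gt0P; exists set0.
    by apply/is_cliqueP => x y; rewrite inE.
  have sub : (k <= size (enum S))%N by rewrite -cardE -SE.
  apply/card_gt0P; exists [set x in take k (enum S)].
  have subS : [set x in take k (enum S)] \subset S.
    by apply/subsetP => x; rewrite inE => /mem_take; rewrite mem_enum.
  rewrite inE subsetT (is_clique_subset subS cS) andbT /= cardsE.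
  by rewrite (card_uniqP (take_uniq _ (enum_uniq S))) size_takel.
rewrite !num_cliquesE.
have [v [p [pv lek ratio]]] := fan_of_ratio hk Nk.
set x := _ / _; have x_le : x <= (size p - k.-1)%:R.
  by rewrite ler_pdivrMr ?ltr0n // -!natrM ler_nat.
split.
  exists (size p); split; last exact: fan_contains_join pv.
  have -> : (size p)%:R = (size p - k.-1)%:R + k%:R - 1 :> rat.
    by rewrite -addrA -{2}(prednK (ltnW hk)) -natr1 addrK -natrD subnK.
  by rewrite -!addrA lerD2r.
move=> t t3 tx; apply: fan_has_cycle pv t3 _.
have : (Num.ceil x <= (size p - k.-1)%N)%R by rewrite ceil_le_int.
by move: tx; lia.
Qed.
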